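(* Let $A,B\in\mathcal{H}(d)$ be $d\times d$ complex Hermitian matrices and let $\mathcal{X},\mathcal{Y}\subset\mathbb{C}^d$ be $k$-dimensional subspaces. Let $U\in\mathcal{U}(d)$ be a direct rotation of $\mathcal{X}$ onto $\mathcal{Y}$ and let $\Theta=\Theta(\mathcal{X},\mathcal{Y})\in[0,\pi/2]^k$ be the principal angles between $\mathcal{X}$ and $\mathcal{Y}$ (arranged non-increasingly). Given a $d\times k$ isometry $X$ with range $R(X)=\mathcal{X}$, let $Y_r=UX$ (a $d\times k$ isometry with range $\mathcal{Y}$). Then $$ s(X^*AX-Y_r^*BY_r)\prec_w s(A-B)+\Theta(\mathcal{X},\mathcal{Y})\,\frac{\mathrm{Spr}^+(A)+\mathrm{Spr}^+(B)}{2}, $$ where submajorization, sums and (entrywise) products between vectors of possibly different lengths are interpreted by padding with zeros on the right.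
   Context: For a matrix $Z$, $s(Z)$ denotes the vector of singular values counting multiplicities arranged non-increasingly; for Hermitian $A$, $\lambda(A)=(\lambda_1(A)\ge\dots\ge\lambda_d(A))$ are its eigenvalues counting multiplicities. For $x,y\in\mathbb{R}^k$, $x\prec_w y$ (submajorization) means $\sum_{i=1}^r x_i^\downarrow\le\sum_{i=1}^r y_i^\downarrow$ for all $r=1,\dots,k$, where $x^\downarrow$ is the non-increasing rearrangement. For vectors with non-negative entries of different lengths, submajorization, sums and entrywise products are defined after appending zeros to the shorter vector. Spectral spread: for $A\in\mathcal{H}(d)$ and $h=\lfloor d/2\rfloor$, $\mathrm{Spr}^+(A)=(\lambda_j(A)-\lambda_{d-j+1}(A))_{j=1}^h\in\mathbb{R}_{\ge0}^h$. Principal angles: for $k$-dimensional subspaces $\mathcal{X},\mathcal{Y}$ with $d\times k$ isometries $X,Y$ ($X^*X=Y^*Y=I_k$) with ranges $\mathcal{X},\mathcal{Y}$, $\Theta(\mathcal{X},\mathcal{Y})=(\theta_j)_{j=1}^k\in[0,\pi/2]^k$ is defined by $\cos\theta_j=s_{k-j+1}(X^*Y)$, so $\theta_1\ge\dots\ge\theta_k$. Direct rotation: let $\mathcal{G}=[(\mathcal{X}\cap\mathcal{Y})\oplus(\mathcal{X}\cap\mathcal{Y}^\perp)\oplus(\mathcal{X}^\perp\cap\mathcal{Y})\oplus(\mathcal{X}^\perp\cap\mathcal{Y}^\perp)]^\perp$, $\mathcal{S}_1=(\mathcal{X}\cap\mathcal{Y}^\perp)\oplus(\mathcal{X}\cap\mathcal{G})$,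 $\mathcal{S}_2=(\mathcal{X}^\perp\cap\mathcal{Y})\oplus(\mathcal{X}^\perp\cap\mathcal{G})$, $\mathcal{S}_3=(\mathcal{X}^\perp\cap\mathcal{Y})\oplus(\mathcal{Y}\cap\mathcal{G})$ (with $\dim\mathcal{S}_1=\dim\mathcal{S}_2=\dim\mathcal{S}_3=:m$), let $\Theta'=\Theta(\mathcal{S}_1,\mathcal{S}_3)$, $C=\mathrm{diag}(\cos\Theta')$, $S=\mathrm{diag}(\sin\Theta')\in M_m(\mathbb{C})$. A unitary $U\in\mathcal{U}(d)$ is a direct rotation from $\mathcal{X}$ onto $\mathcal{Y}$ if there is an orthonormal basis of $\mathbb{C}^d$ obtained by juxtaposing orthonormal bases of $\mathcal{X}\cap\mathcal{Y}$, $\mathcal{S}_1$, $\mathcal{S}_2$, $\mathcal{X}^\perp\cap\mathcal{Y}^\perp$ in which $U$ has block form $\begin{pmatrix}I&0&0&0\\0&C&-S&0\\0&S&C&0\\0&0&0&I\end{pmatrix}$. *)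

(* Defs.v *)
From HB Require Import structures.
From mathcomp Require Import all_boot all_order all_algebra.
From mathcomp Require Import complex.
From mathcomp Require Import reals trigo.

Set Implicit Arguments.
Unset Strict Implicit.
Unset Printing Implicit Defensive.

Import Order.TTheory GRing.Theory Num.Theory.
Local Open Scope ring_scope.

Section Defs.
Variable R : realType.
Local Notation C := R[i].

Definition hadj m n (M : 'M[C]_(m, n)) : 'M[C]_(n, m) := (map_mx Num.conj M)^T.

Definition herm_mx n (A : 'M[C]_n) : Prop := hadj A = A.
Definition unitary_mx n (U : 'M[C]_n) : Prop := hadj U *m U = 1%:M.
Definition isom_mx d k (X : 'M[C]_(d, k)) : Prop := hadj X *m X = 1%:M.

Definition sort_dec (s : seq R) : seq R := sort (fun a b : R => b <= a) s.

(* eigenvalues counted with multiplicity (roots of the characteristic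
   polynomial), arranged non-increasingly; for Hermitian A they are real and
   we take their real parts *)
Definition eigvals n (A : 'M[C]_n) : seq R :=
  sort_dec (map (@complex.Re R) (sval (closed_field_poly_normal (char_poly A)))).

(* singular values of Z : 'M_(m,n): square roots of the eigenvalues of Z^* Z,
   non-increasing (n values; any extra ones are zeros, harmless under the
   zero-padding convention) *)
Definition svals m n (Z : 'M[C]_(m, n)) : seq R :=
  map Num.sqrt (eigvals (hadj Z *m Z)).

Definition spr n (A : 'M[C]_n) : seq R :=
  let l := eigvals A in
  [seq nth 0 l j - nth 0 l (n - j.+1) | j <- iota 0 n./2].

(* principal angles between the ranges of isometries X, Y:
   cos theta_j = s_{k-j+1}(X^* Y), theta non-increasing *)
Definition angles d k (X Y : 'M[C]_(d, k)) : seq R :=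
  map acos (rev (svals (hadj X *m Y))).

Definition padz n (s : seq R) : seq R := s ++ nseq (n - size s) 0.
Definition vadd (x y : seq R) : seq R :=
  let n := maxn (size x) (size y) in
  [seq p.1 + p.2 | p <- zip (padz n x) (padz n y)].
Definition vmul (x y : seq R) : seq R :=
  let n := maxn (size x) (size y) in
  [seq p.1 * p.2 | p <- zip (padz n x) (padz n y)].
Definition vscale (c : R) (x : seq R) : seq R := map ( *%R c) x.

Definition submaj (x y : seq R) : Prop :=
  let n := maxn (size x) (size y) in
  let xs := sort_dec (padz n x) in
  let ys := sort_dec (padz n y) in
  forall r : nat, (r <= n)%N ->
    \sum_(i < r) nth 0 xs i <= \sum_(i < r) nth 0 ys i.

(* Subspaces of C^d are represented as row spaces of matrices 'M_(_, d);
   a column vector x in C^d corresponds to the row x^T.  The range of a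
   d x m matrix W is the row space of W^T. *)
Definition perp p d (M : 'M[C]_(p, d)) : 'M[C]_d := kermx (hadj M).

Definition rcplx (x : R) : C := (x%:C)%C.

Definition direct_rotation p q d (Xs : 'M[C]_(p, d)) (Ys : 'M[C]_(q, d))
    (U : 'M[C]_d) : Prop :=
  let XcapY := (Xs :&: Ys)%MS in
  let XcapYp := (Xs :&: perp Ys)%MS in
  let XpcapY := (perp Xs :&: Ys)%MS in
  let XpcapYp := (perp Xs :&: perp Ys)%MS in
  let G := perp (XcapY + XcapYp + XpcapY + XpcapYp)%MS in
  let S1 := (XcapYp + (Xs :&: G))%MS in
  let S2 := (XpcapY + (perp Xs :&: G))%MS in
  let S3 := (XpcapY + (Ys :&: G))%MS in
  exists (m0 m m3 : nat) (W0 : 'M[C]_(d, m0)) (W1 W2 : 'M[C]_(d, m))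
         (W3 : 'M[C]_(d, m3)) (V3 : 'M[C]_(d, m)),
    let W := row_mx (row_mx (row_mx W0 W1) W2) W3 in
    let th := angles W1 V3 in
    let Cm := diag_mx (\row_(i < m) rcplx (cos (nth 0 th i))) in
    let Sm := diag_mx (\row_(i < m) rcplx (sin (nth 0 th i))) in
    [/\ (m0 + m + m + m3)%N = d,
        isom_mx W,
        [/\ (W0^T == XcapY)%MS, (W1^T == S1)%MS, (W2^T == S2)%MS
          & (W3^T == XpcapYp)%MS],
        isom_mx V3 /\ (V3^T == S3)%MS &
        [/\ U *m W0 = W0,
            U *m W1 = W1 *m Cm + W2 *m Sm,
            U *m W2 = W2 *m Cm - W1 *m Sm
          & U *m W3 = W3]].

End Defs.

(* Main.v *)
Require Import Defs.
From HB Require Import structures.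
From mathcomp Require Import all_boot all_order all_algebra.
From mathcomp Require Import complex ring lra zify spectral perm.
From mathcomp Require Import classical_sets reals topology normedtype derive trigo.

(** Ky Fan: the sum of the [r] largest singular values of [Z] is the maximum of
    [Re tr (P^* Z Q)] over contractions [P], [Q] of squared Frobenius norm at
    most [r], so every step is a bound on such traces.
    Write [X^*AX - Yr^*BYr] as the mean of [X^*(A-B)X + Yr^*(A-B)Yr] and
    [(X^*AX - Yr^*AYr) + (X^*BX - Yr^*BYr)]; the first part is controlled by
    [s(A-B)].  For the second, rotate by half the angles: if [F] and [F'] are the
    two frames in which [U F = F cos T + F' sin T], with images [E] and [E']
    under the half rotation, then [F = E cos(T/2) - E' sin(T/2)] and
    [U F = E cos(T/2) + E' sin(T/2)], so the difference of the compressions of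
    [A] is [-2 (M + M^H)] with [M = cos(T/2) (E^* A E') sin(T/2)].  As [E] and
    [E'] have orthogonal ranges, [2 s(E^* A E')] is submajorized by [Spr^+(A)],
    and [2 sin(T/2) <= T] concludes. *)

Import Order.TTheory GRing.Theory Num.Theory numFieldNormedType.Exports.
Local Open Scope ring_scope.

Section DirectRotation.

Set Implicit Arguments.
Unset Strict Implicit.
Unset Printing Implicit Defensive.

Local Notation "M ^H" := (hadj M) (at level 1, left associativity, format "M ^H").

(** * Orthogonal decompositions *)

Section Orthogonal.
Variable C : numClosedFieldType.

(** At [R[i]] this is convertible to [perp], so the results below apply directly to the subspaces in
    [direct_rotation]. *)
Definition orth p d (M : 'M[C]_(p, d)) : 'M[C]_d := kermx (map_mx Num.conj M)^T.

Lemma orthP p q d (A : 'M[C]_(p, d)) (B : 'M[C]_(q, d)) :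
  reflect (A *m (map_mx Num.conj B)^T = 0) (A <= orth B)%MS.
Proof. exact: sub_kermxP. Qed.

Lemma orth_sym p q d (A : 'M[C]_(p, d)) (B : 'M[C]_(q, d)) :
  (A <= orth B)%MS -> (B <= orth A)%MS.
Proof.
move=> /orthP/(congr1 (fun M => map_mx Num.conj M^T)) AB; apply/orthP.
rewrite map_trmx; move: AB; rewrite trmx_mul trmxK map_mxM -map_mx_comp.
by rewrite (map_mx_id (@conjCK _)) trmx0 map_mx0.
Qed.

Lemma orth_sub p1 p2 q1 q2 d (A1 : 'M[C]_(p1, d)) (A2 : 'M[C]_(p2, d))
    (B1 : 'M[C]_(q1, d)) (B2 : 'M[C]_(q2, d)) :
  (A1 <= A2)%MS -> (B1 <= B2)%MS -> (A2 <= orth B2)%MS -> (A1 <= orth B1)%MS.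
Proof.
move=> A12 /submxP[D ->] /orthP AB; apply/orthP; have /submxP[D' ->] := A12.
by rewrite map_mxM trmx_mul -mulmxA (mulmxA A2) AB mul0mx mulmx0.
Qed.

(** The whole space is [Z + orth Z]; intersecting with [X], which contains [Z], and applying the
    modular law gives the inclusion. *)
Lemma orth_decomp p q d (Z : 'M[C]_(p, d)) (X : 'M[C]_(q, d)) :
  (Z <= X)%MS -> (X <= Z + X :&: orth Z)%MS.
Proof.
move=> ZX; rewrite (capmxC X) matrix_modl // sub_capmx submx_refl andbT.
have /eqmxP/andP[_ full] := addsmx_ortho Z.
apply: submx_trans (submx1 X) (submx_trans full _); apply: addsmxS => //.
by apply/orthP; rewrite map_trmx; apply/orthomx1P.
Qed.

(** Splitting [N1 + N2] off [X] leaves vectors of [X], hence orthogonal to [N3] and [N4], so the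
    remainder lies in [G]; the argument for [Y] is the same with [N1 + N3]. The common part [W0] is
    put last because its zero angles come last in [angles]. *)
Lemma two_subspaces p q d m0 m1 m2 (X : 'M[C]_(p, d)) (Y : 'M[C]_(q, d))
    (W0 : 'M[C]_(m0, d)) (W1 : 'M[C]_(m1, d)) (V1 : 'M[C]_(m2, d)) :
  let N1 := (X :&: Y)%MS in
  let N2 := (X :&: orth Y)%MS in
  let N3 := (orth X :&: Y)%MS in
  let N4 := (orth X :&: orth Y)%MS in
  let G := orth (N1 + N2 + N3 + N4)%MS in
  (W0 == N1)%MS -> (W1 == N2 + X :&: G)%MS -> (V1 == N3 + Y :&: G)%MS ->
  [/\ (X == col_mx W1 W0)%MS, (Y == col_mx V1 W0)%MS & (V1 <= orth W0)%MS].
Proof.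
move=> N1 N2 N3 N4 G eW0 eW1 eV1.
have /andP[sW0 W0s] := eW0; have /andP[sW1 W1s] := eW1.
have /andP[sV1 V1s] := eV1.
have subG r (M : 'M[C]_(r, d)) : (M <= orth N1)%MS -> (M <= orth N2)%MS ->
    (M <= orth N3)%MS -> (M <= orth N4)%MS -> (M <= G)%MS.
  move=> M1 M2 M3 M4; apply: orth_sym.
  by rewrite !addsmx_sub (orth_sym M1) (orth_sym M2) (orth_sym M3) (orth_sym M4).
have capG r (M : 'M[C]_(r, d)) (K L : 'M[C]_d) : 
    (M :&: orth (K + L)%MS <= orth K)%MS /\ (M :&: orth (K + L)%MS <= orth L)%MS.
  have h := submx_refl (orth (K + L)%MS).
  split.
    exact: (orth_sub (capmxSr M _) (addsmxSl K L) h).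
  exact: (orth_sub (capmxSr M _) (addsmxSr K L) h).
have XX : (X <= orth (orth X))%MS by exact: orth_sym.
have YY : (Y <= orth (orth Y))%MS by exact: orth_sym.
have XE : (X <= N1 + (N2 + X :&: G))%MS.
  have ZX : (N1 + N2 <= X)%MS by rewrite addsmx_sub !capmxSl.
  apply: submx_trans (orth_decomp ZX) _; rewrite addsmxA addsmxS //.
  rewrite sub_capmx capmxSl /=; have [h1 h2] := capG _ X N1 N2; apply: subG => //.
    exact: (orth_sub (capmxSl _ _) (capmxSl _ _) XX).
  exact: (orth_sub (capmxSl _ _) (capmxSl _ _) XX).
have YE : (Y <= N1 + (N3 + Y :&: G))%MS.
  have ZY : (N1 + N3 <= Y)%MS by rewrite addsmx_sub !capmxSr.
  apply: submx_trans (orth_decomp ZY) _; rewrite addsmxA addsmxS //.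
  rewrite sub_capmx capmxSl /=; have [h1 h2] := capG _ Y N1 N3; apply: subG => //.
    exact: (orth_sub (capmxSl _ _) (capmxSr _ _) YY).
  exact: (orth_sub (capmxSl _ _) (capmxSr _ _) YY).
split.
- apply/andP; split.
    apply: submx_trans XE _; rewrite -addsmxE addsmxC addsmxS //.
  rewrite col_mx_sub (submx_trans sW0 (capmxSl _ _)) andbT.
  by apply: submx_trans sW1 _; rewrite addsmx_sub !capmxSl.
- apply/andP; split.
    apply: submx_trans YE _; rewrite -addsmxE addsmxC addsmxS //.
  rewrite col_mx_sub (submx_trans sW0 (capmxSr _ _)) andbT.
  by apply: submx_trans sV1 _; rewrite addsmx_sub capmxSr capmxSl.
- apply: (orth_sub sV1 sW0); rewrite addsmx_sub; apply/andP; split.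
    exact: (orth_sub (capmxSl _ _) (capmxSl _ _) (submx_refl _)).
  apply: (orth_sub (capmxSr _ _) _ (submx_refl G)).
  by rewrite -!addsmxA addsmxSl.
Qed.

End Orthogonal.

(** * Traces and contractions *)

Section Trace.
Variable R : realType.
Local Notation C := R[i].

Lemma rcplxE (x : R) : rcplx x = x%:C%C. Proof. by []. Qed.
Lemma rcplxM (x y : R) : rcplx (x * y) = rcplx x * rcplx y.
Proof. exact: rmorphM. Qed.
Lemma rcplx_conj (x : R) : (rcplx x)^* = rcplx x.
Proof. exact: conjc_real. Qed.

Lemma ReD (x y : C) : complex.Re (x + y) = complex.Re x + complex.Re y.
Proof. by case: x y => [a b] [c d]. Qed.
Lemma ReN (x : C) : complex.Re (- x) = - complex.Re x.
Proof. by case: x => [a b]. Qed.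
Lemma ReMl (a : R) (x : C) : complex.Re (rcplx a * x) = a * complex.Re x.
Proof. by case: x => [b c] /=; rewrite mul0r subr0. Qed.
Lemma ReJ (x : C) : complex.Re x^* = complex.Re x.
Proof. by case: x. Qed.
Lemma Re_ge0 (x : C) : 0 <= x -> 0 <= complex.Re x.
Proof. by rewrite lecE => /andP[]. Qed.
Lemma Re_sum I (r : seq I) (P : pred I) (F : I -> C) :
  complex.Re (\sum_(i <- r | P i) F i) = \sum_(i <- r | P i) complex.Re (F i).
Proof. exact: (big_morph _ ReD). Qed.

Section Adjoint.
Variables m n p : nat.
Implicit Types (M N : 'M[C]_(m, n)).

Lemma hadjK M : M^H^H = M.
Proof. by apply/matrixP=> i j; rewrite !mxE conjCK. Qed.
Lemma hadjM M (N : 'M[C]_(n, p)) : (M *m N)^H = N^H *m M^H.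
Proof. by rewrite /hadj map_mxM trmx_mul. Qed.
Lemma hadjD M N : (M + N)^H = M^H + N^H.
Proof. by rewrite /hadj map_mxD linearD. Qed.
Lemma hadjN M : (- M)^H = - M^H.
Proof. by rewrite /hadj map_mxN linearN. Qed.
Lemma hadjB M N : (M - N)^H = M^H - N^H.
Proof. by rewrite hadjD hadjN. Qed.
Lemma hadjZ (a : R) M : (rcplx a *: M)^H = rcplx a *: M^H.
Proof. by rewrite /hadj map_mxZ linearZ /= rcplx_conj. Qed.
Lemma hadj0 : (0 : 'M[C]_(m, n))^H = 0.
Proof. by rewrite /hadj map_mx0 linear0. Qed.
Lemma hadj_row_mx M (N : 'M[C]_(m, p)) : (row_mx M N)^H = col_mx M^H N^H.
Proof. by rewrite /hadj map_row_mx tr_row_mx. Qed.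
End Adjoint.

Definition rdiag n (f : nat -> R) : 'M[C]_n := diag_mx (\row_i rcplx (f i)).

Lemma hadj_rdiag n f : (rdiag n f)^H = rdiag n f.
Proof.
rewrite /hadj /rdiag map_diag_mx tr_diag_mx; congr diag_mx.
by apply/rowP=> i; rewrite !mxE; exact: rcplx_conj.
Qed.
Lemma eq_rdiag n f g : (forall i, (i < n)%N -> f i = g i) -> rdiag n f = rdiag n g.
Proof. by move=> fg; congr diag_mx; apply/rowP=> i; rewrite !mxE fg. Qed.
Lemma rdiagM n f g : rdiag n f *m rdiag n g = rdiag n (fun i => f i * g i).
Proof.
by rewrite mulmx_diag; congr diag_mx; apply/rowP=> i; rewrite !mxE rcplxM.
Qed.
Lemma rdiagD n f g : rdiag n f + rdiag n g = rdiag n (fun i => f i + g i).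
Proof.
rewrite /rdiag -linearD /=; congr diag_mx; apply/rowP=> i.
by rewrite !mxE [RHS]rmorphD.
Qed.
Lemma rdiagN n f : - rdiag n f = rdiag n (fun i => - f i).
Proof.
rewrite /rdiag -linearN /=; congr diag_mx; apply/rowP=> i.
by rewrite !mxE [RHS]rmorphN.
Qed.
Lemma rdiag_const n a : rdiag n (fun=> a) = rcplx a *: 1%:M.
Proof. by apply/matrixP=> i j; rewrite !mxE mulr_natr. Qed.
Lemma rdiag1 n : rdiag n (fun=> 1) = 1%:M.
Proof. by rewrite rdiag_const scale1r. Qed.

Definition retr n (M : 'M[C]_n) : R := complex.Re (\tr M).

Lemma retrD n (M N : 'M[C]_n) : retr (M + N) = retr M + retr N.
Proof. by rewrite /retr mxtraceD ReD. Qed.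
Lemma retrN n (M : 'M[C]_n) : retr (- M) = - retr M.
Proof. by rewrite /retr linearN ReN. Qed.
Lemma retrB n (M N : 'M[C]_n) : retr (M - N) = retr M - retr N.
Proof. by rewrite retrD retrN. Qed.
Lemma retrZ n a (M : 'M[C]_n) : retr (rcplx a *: M) = a * retr M.
Proof. by rewrite /retr mxtraceZ ReMl. Qed.
Lemma retrC m n (M : 'M[C]_(m, n)) (N : 'M[C]_(n, m)) :
  retr (M *m N) = retr (N *m M).
Proof. by rewrite /retr mxtrace_mulC. Qed.
Lemma retr_hadj n (M : 'M[C]_n) : retr M^H = retr M.
Proof. by rewrite /retr /hadj mxtrace_tr trace_map_mx ReJ. Qed.
Lemma retr_rdiag n (M : 'M[C]_n) f :
  retr (rdiag n f *m M) = \sum_(i < n) f i * complex.Re (M i i).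
Proof.
rewrite /retr /mxtrace Re_sum; apply: eq_bigr => i _.
by rewrite mul_diag_mx !mxE ReMl.
Qed.

Definition nF m n (M : 'M[C]_(m, n)) : R := retr (M^H *m M).

Lemma nF_ge0 m n (M : 'M[C]_(m, n)) : 0 <= nF M.
Proof.
rewrite /nF /retr Re_sum sumr_ge0 // => i _; rewrite Re_ge0 // mxE.
by apply: sumr_ge0 => j _; rewrite !mxE mulrC mul_conjC_ge0.
Qed.
Lemma nF_eq0 m n (M : 'M[C]_(m, n)) : nF M = 0 -> M = 0.
Proof.
move=> M0; apply/matrixP=> i j; rewrite mxE; apply/eqP.
rewrite -mul_conjC_eq0 -normCK; apply/eqP.
have e (i' : 'I_m) (j' : 'I_n) : (M^H j' i') * M i' j' = rcplx (complex.Re (M^H j' i' * M i' j')).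
  by rewrite !mxE; case: (M i' j') => a b; apply/eqP; rewrite eq_complex /= eqxx /=; apply/eqP; ring.
have ge (i' : 'I_m) (j' : 'I_n) : 0 <= complex.Re (M^H j' i' * M i' j').
  by rewrite Re_ge0 // !mxE mulrC mul_conjC_ge0.
have : \sum_j' \sum_i' complex.Re (M^H j' i' * M i' j') = 0.
  rewrite -[RHS]M0 /nF /retr Re_sum; apply: eq_bigr => j' _.
  by rewrite mxE Re_sum.
move/eqP; rewrite psumr_eq0; last by move=> j' _; apply: sumr_ge0.
move=> /allP /(_ j (mem_index_enum _)) /=; rewrite psumr_eq0 //.
move=> /allP /(_ i (mem_index_enum _)) /= /eqP h.
by move: (e i j); rewrite h mxE mulrC mxE -normCK.
Qed.
Lemma nF_hadj m n (M : 'M[C]_(m, n)) : nF M^H = nF M.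
Proof. by rewrite /nF hadjK retrC. Qed.
Lemma nFD m n (M N : 'M[C]_(m, n)) :
  nF (M + N) = nF M + nF N + retr (M^H *m N) *+ 2.
Proof.
rewrite /nF hadjD mulmxDl !mulmxDr !retrD -[retr (N^H *m M)]retr_hadj.
by rewrite hadjM hadjK; ring.
Qed.
Lemma nFN m n (M : 'M[C]_(m, n)) : nF (- M) = nF M.
Proof. by rewrite /nF hadjN mulNmx mulmxN opprK. Qed.
Lemma nFB m n (M N : 'M[C]_(m, n)) :
  nF (M - N) = nF M + nF N - retr (M^H *m N) *+ 2.
Proof. by rewrite nFD nFN mulmxN retrN mulNrn. Qed.
Lemma nFZ m n a (M : 'M[C]_(m, n)) : nF (rcplx a *: M) = a ^+ 2 * nF M.
Proof.
by rewrite /nF hadjZ -scalemxAl -scalemxAr scalerA -rcplxM retrZ expr2.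
Qed.
Lemma retr_le_nF m n (M N : 'M[C]_(m, n)) :
  retr (M^H *m N) *+ 2 <= nF M + nF N.
Proof. by rewrite -subr_ge0 -nFB nF_ge0. Qed.

(** Operator norm at most one, tested on matrices with any number of columns, so that products of
    contractions need no operator norm. *)
Definition contr m n (P : 'M[C]_(m, n)) :=
  forall q (x : 'M[C]_(n, q)), nF (P *m x) <= nF x.

Lemma contr_isom m n (P : 'M[C]_(m, n)) : isom_mx P -> contr P.
Proof.
by move=> iP q x; rewrite /nF hadjM -mulmxA (mulmxA P^H) iP mul1mx.
Qed.
Lemma contrM m n p (P : 'M[C]_(m, n)) (Q : 'M[C]_(n, p)) :
  contr P -> contr Q -> contr (P *m Q).
Proof. by move=> cP cQ q x; rewrite -mulmxA (le_trans (cP _ _)). Qed.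
(** Expanding [0 <= nF (x - P *m (P^H *m x))] bounds [2 * nF (P^H *m x)] by
    [nF x + nF (P *m (P^H *m x))], and the last term is at most [nF (P^H *m x)]. *)
Lemma contr_hadj m n (P : 'M[C]_(m, n)) : contr P -> contr P^H.
Proof.
move=> cP q x.
have := nF_ge0 (x - P *m (P^H *m x)); rewrite nFB.
have -> : retr (x^H *m (P *m (P^H *m x))) = nF (P^H *m x).
  by rewrite /nF hadjM hadjK -!mulmxA.
by have := cP q (P^H *m x); lra.
Qed.
Lemma contrN m n (P : 'M[C]_(m, n)) : contr P -> contr (- P).
Proof. by move=> cP q x; rewrite mulNmx nFN. Qed.
Lemma nF_contr_r m n p (P : 'M[C]_(m, n)) (Q : 'M[C]_(n, p)) :
  contr Q -> nF (P *m Q) <= nF P.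
Proof.
by move=> /contr_hadj cQ; rewrite -nF_hadj hadjM -[leRHS]nF_hadj; apply: cQ.
Qed.
Lemma contr_rdiag n f : (forall i, (i < n)%N -> `|f i| <= 1) -> contr (rdiag n f).
Proof.
move=> f1 q x.
rewrite /nF hadjM hadj_rdiag [in leRHS]retrC -mulmxA (mulmxA (rdiag _ _)) rdiagM.
rewrite retrC -mulmxA -[X in _ <= retr X]mul1mx -rdiag1 !retr_rdiag.
apply: ler_sum => i _; rewrite ler_wpM2r //.
  rewrite Re_ge0 // mxE sumr_ge0 // => j _.
  by rewrite !mxE mul_conjC_ge0.
by have := f1 i (ltn_ord i); rewrite -expr2 -real_normK ?num_real // => h;
  rewrite exprn_ile1.
Qed.

(** A relaxation of having [r] orthonormal columns: it survives left multiplication by contractions,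
    leaves the number of columns free and allows [r] to exceed the dimensions. *)
Definition frame (r : nat) m n (P : 'M[C]_(m, n)) := contr P /\ nF P <= r%:R.

Lemma frameM_l r m n p (P : 'M[C]_(m, n)) (Q : 'M[C]_(n, p)) :
  contr P -> frame r Q -> frame r (P *m Q).
Proof.
by move=> cP [cQ rQ]; split; [exact: contrM|exact: le_trans (cP _ _) rQ].
Qed.
Lemma frameN r m n (P : 'M[C]_(m, n)) : frame r P -> frame r (- P).
Proof. by case=> cP rP; split; [exact: contrN|rewrite nFN]. Qed.

Definition below (l : nat) (i : nat) : R := (i < l)%:R.

Lemma sum_below n l (g : nat -> R) :
  \sum_(i < n) below l i * g i = \sum_(i < minn n l) g i.
Proof.
elim: n => [|n IH]; first by rewrite min0n !big_ord0.
rewrite big_ord_recr IH /= /below; case: (ltnP n l) => nl.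
  by rewrite mul1r (minn_idPl nl) big_ord_recr.
by rewrite mul0r addr0 (minn_idPr (leqW nl)).
Qed.
Lemma below_idem n l : rdiag n (below l) *m rdiag n (below l) = rdiag n (below l).
Proof.
by rewrite rdiagM; apply: eq_rdiag => i _; rewrite /below; case: (_ < _)%N; rewrite /= ?mulr1 ?mulr0.
Qed.
Lemma frame_below n l : frame l (rdiag n (below l)).
Proof.
split.
  apply: contr_rdiag => i _; rewrite /below ger0_norm ?ler0n //.
  by case: (_ < _)%N.
rewrite /nF hadj_rdiag below_idem -[X in retr X]mulmx1 retr_rdiag.
rewrite (eq_bigr (fun i : 'I_n => below l i * 1)); last first.
  by move=> i _; rewrite mxE eqxx.
by rewrite (sum_below n l (fun=> 1)) sumr_const card_ord ler_nat geq_minr.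
Qed.

(** Summation by parts, done as an induction on the sharper bound by the last weight times the full
    sum of [c]. *)
Lemma abel_ge0 (s c : nat -> R) k :
  (forall i, s i.+1 <= s i) -> (forall i, 0 <= s i) ->
  (forall l, (l <= k)%N -> 0 <= \sum_(i < l) c i) ->
  0 <= \sum_(i < k) s i * c i.
Proof.
move=> sd s0 c0.
suff : s k * \sum_(i < k) c i <= \sum_(i < k) s i * c i.
  by apply: le_trans; rewrite mulr_ge0 // c0.
elim: k c0 => [|k IH] c0; first by rewrite !big_ord0 mulr0.
have {}IH := IH (fun l lk => c0 l (leqW lk)).
apply: le_trans (_ : s k * \sum_(i < k.+1) c i <= _).
  by rewrite ler_wpM2r // c0.
by rewrite !big_ord_recr /= mulrDr lerD2r.
Qed.

(* Abel summation reduces the weighted bound to the truncations of [T] to its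
   first [l] columns, for which the pair [P], [Q] may be replaced by
   [P *m Q^H], truncated, and the truncation itself. *)
Lemma weighted_trace m n q (T : 'M[C]_(m, n)) (g s : nat -> R) r
    (P : 'M[C]_(m, q)) (Q : 'M[C]_(n, q)) :
  (forall i, s i.+1 <= s i) -> (forall i, 0 <= s i) -> (forall i, 0 <= g i) ->
  (forall l p (P' : 'M[C]_(m, p)) (Q' : 'M[C]_(n, p)),
     frame l P' -> frame l Q' -> retr (P'^H *m T *m Q') <= \sum_(i < l) g i) ->
  frame r P -> frame r Q ->
  retr (P^H *m T *m rdiag n s *m Q) <= \sum_(i < r) s i * g i.
Proof.
move=> sd s0 g0 HT fP fQ.
have mono k (h : nat -> R) : (forall i, 0 <= h i) ->
    \sum_(i < minn k r) h i <= \sum_(i < r) h i.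
  move=> h0; move: (minn k r) (geq_minr k r) => l lr.
  by rewrite -[in leRHS](subnKC lr) big_split_ord /= lerDl sumr_ge0.
(* By cyclicity the trace with diagonal weight [f] is the sum of [f] against the diagonal of
   [Q *m P^H *m T]. The default 0 only makes [a] total: all sums stop at [n]. *)
pose a (i : nat) := if insub i is Some j then complex.Re ((Q *m P^H *m T) j j) else 0.
have aE f : retr (P^H *m T *m rdiag n f *m Q) = \sum_(i < n) f i * a i.
  rewrite -mulmxA retrC -mulmxA retr_rdiag mulmxA.
  by apply: eq_bigr => i _; rewrite /a valK.
rewrite aE; apply: (@le_trans _ _ (\sum_(i < n) s i * (below r i * g i))); last first.
  rewrite (eq_bigr (fun i : 'I_n => below r i * (s i * g i))); last first.
    by move=> i _; rewrite mulrCA.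
  rewrite (sum_below n r (fun i => s i * g i)).
  by apply: (mono n (fun i => s i * g i)) => i; rewrite mulr_ge0.
rewrite -subr_ge0 -sumrB.
rewrite (eq_bigr (fun i : 'I_n => s i * (below r i * g i - a i))); last first.
  by move=> i _; rewrite mulrBr.
apply: (abel_ge0 (c := fun i => below r i * g i - a i)) => // l ln.
rewrite sumrB subr_ge0 (sum_below l r g).
have -> : \sum_(i < l) a i = retr (P^H *m T *m rdiag n (below l) *m Q).
  by rewrite aE (sum_below n l a) (minn_idPr ln).
have fl := frame_below n l.
case: (leqP l r) => lr.
  rewrite -below_idem -!mulmxA retrC -!mulmxA retrC -!mulmxA retrC -!mulmxA.
  have := HT l n (P *m (Q^H *m rdiag n (below l))) (rdiag n (below l)).
  rewrite !hadjM hadjK hadj_rdiag -!mulmxA; apply => //.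
  apply: frameM_l; first by case: fP.
  by apply: frameM_l => //; apply: contr_hadj; case: fQ.
(* When [r < l] the bound only involves [g] up to [r], and truncating [Q] keeps it an [r]-frame, so
   [HT] applies at [r] itself. *)
rewrite -mulmxA; apply: HT => //.
by apply: frameM_l => //; case: fl.
Qed.

End Trace.

(** * Spectral and singular value decompositions *)

Section Spectral.
Variable R : realType.
Local Notation C := R[i].

Definition ev (l : seq R) (i : nat) : R := nth 0 l i.

Lemma char_poly_similar n (M D V W : 'M[C]_n) :
  V *m W = 1%:M -> M = V *m D *m W -> char_poly M = char_poly D.
Proof.
move=> VW ->; pose P := map_mx (@polyC C).
have PVW : P _ _ V *m P _ _ W = 1%:M by rewrite /P -map_mxM VW map_mx1.
rewrite /char_poly /char_poly_mx 2!map_mxM -/(P _ _ V) -/(P _ _ W).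
have {1}-> : 'X%:M = P _ _ V *m 'X%:M *m P _ _ W.
  by rewrite scalar_mxC -mulmxA PVW mulmx1.
rewrite -mulmxBl -mulmxBr !det_mulmx mulrAC -det_mulmx PVW det1.
by rewrite mul1r.
Qed.

Lemma char_poly_rdiag n (l : seq R) : size l = n ->
  char_poly (rdiag n (ev l)) = \prod_(x <- map (@rcplx R) l) ('X - x%:P).
Proof.
move=> sl; rewrite char_poly_trig; last first.
  apply/is_trig_mxP => i j ij; rewrite !mxE.
  by rewrite (_ : i == j = false) // -val_eqE ltn_eqF.
rewrite big_map (big_nth 0) sl big_mkord; apply: eq_bigr => i _.
by rewrite !mxE eqxx mulr1n.
Qed.

Lemma size_eigvals n (A : 'M[C]_n) : size (eigvals A) = n.
Proof.
rewrite size_sort size_map; case: closed_field_poly_normal => r /= e.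
have := size_char_poly A; rewrite e size_scale ?size_prod_XsubC; first by case.
by rewrite lead_coef_eq0 monic_neq0 // char_poly_monic.
Qed.

Lemma eigvals_diagonal n (A V : 'M[C]_n) (l : seq R) :
  size l = n -> unitary_mx V -> A = V *m rdiag n (ev l) *m V^H ->
  eigvals A = sort_dec l.
Proof.
move=> sl uV AE; rewrite /eigvals; case: closed_field_poly_normal => r /=.
rewrite (monicP (char_poly_monic A)) scale1r (char_poly_similar (mulmx1C uV) AE).
rewrite char_poly_rdiag // => /prod_XsubC_eq rl.
apply/perm_sortP.
- by move=> x y; exact: le_total.
- by move=> x y z yx zy; exact: le_trans zy yx.
- by move=> x y /andP[yx xy]; apply: le_anti; rewrite yx xy.
rewrite perm_sym in rl; have := perm_map (@complex.Re R) rl.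
by rewrite -map_comp map_id_in.
Qed.

Lemma hermitian_spectral n (A : 'M[C]_n) : herm_mx A ->
  exists2 l : seq R, size l = n &
    exists2 V : 'M[C]_n, unitary_mx V & A = V *m rdiag n (ev l) *m V^H.
Proof.
move=> hA.
have hsA : A \is hermsymmx.
  apply/is_hermitianmxP; rewrite expr0 scale1r -{1}hA.
  by apply/matrixP=> i j; rewrite !mxE.
have /mxOverP rl := hermitian_spectral_diag_real hsA.
have /orthomx_spectralP := hermitian_normalmx hsA.
have := spectral_unitarymx A; set P := spectralmx A; set sp := spectral_diag A.
move=> uP; rewrite invmx_unitary // => AE.
have PH : map_mx Num.conj P^T = P^H by apply/matrixP=> i j; rewrite !mxE.
exists (mkseq (fun i => if insub i is Some j then complex.Re (sp 0 j) else 0) n).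
  by rewrite size_mkseq.
exists P^H; first by rewrite /unitary_mx hadjK -PH; apply/eqP.
rewrite hadjK AE PH; congr (_ *m _ *m _); congr diag_mx; apply/rowP=> i.
by rewrite !mxE /ev nth_mkseq // valK rcplxE RRe_real // rl.
Qed.

(** Permuting the columns of a diagonalizing unitary lists the eigenvalues in any order; both the
    sorted order and its reverse are needed for the spread. *)
Lemma spectral_perm n (A : 'M[C]_n) (l : seq R) :
  herm_mx A -> perm_eq l (eigvals A) ->
  exists2 V : 'M[C]_n, unitary_mx V & A = V *m rdiag n (ev l) *m V^H.
Proof.
move=> hA pl; have [l0 sl0 [V0 uV0 AE]] := hermitian_spectral hA.
have {}pl : perm_eq l l0.
  by apply: perm_trans pl _; rewrite (eigvals_diagonal sl0 uV0 AE) perm_sort.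
pose t : n.-tuple R := tcast sl0 (in_tuple l0).
have tE : t = l0 :> seq R by rewrite val_tcast.
rewrite -tE in pl; have /tuple_permP[p lE] := pl.
have evl (i : 'I_n) : ev l i = ev l0 (p i).
  by rewrite /ev lE -(tnth_nth 0 [tuple _ | _ < _]) tnth_mktuple (tnth_nth 0) tE.
exists (col_perm p V0).
  apply/matrixP=> i j; have /matrixP/(_ (p i) (p j)) := uV0.
  rewrite !mxE (inj_eq perm_inj) => <-; apply: eq_bigr => k _.
  by rewrite !mxE.
apply/matrixP=> i j; rewrite AE !mul_mx_diag !mxE.
rewrite (reindex_inj (@perm_inj _ p)); apply: eq_bigr => k _.
by rewrite !mxE evl.
Qed.

Lemma svals_ev (l : seq R) i : Num.sqrt (ev l i) = ev (map Num.sqrt l) i.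
Proof.
rewrite /ev; have [il|il] := ltnP i (size l); first by rewrite (nth_map 0).
by rewrite !nth_default ?size_map // sqrtr0.
Qed.

Lemma gram_rdiag_ge0 m n (M : 'M[C]_(m, n)) l i : (i < n)%N ->
   M^H *m M = rdiag n l -> 0 <= l i.
Proof.
move=> il MM; have := nF_ge0 (M *m delta_mx (Ordinal il) (ord0 : 'I_1)).
rewrite /nF hadjM -mulmxA (mulmxA M^H) MM mulmxA retrC mulmxA.
rewrite retrC retr_rdiag (bigD1 (Ordinal il)) //= big1 => [|j ji].
  rewrite addr0 mxE big_ord1 !mxE /= !eqxx /=.
  by rewrite mul0r subr0 !mulr1.
by rewrite mxE big_ord1 !mxE (negPf ji) /= !mul0r subr0 mulr0.
Qed.

(** Diagonalize [Z^H *m Z] by [V] and take [U] to be [Z *m V] with each column divided by its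
    singular value. Columns of singular value zero become zero, so [U] is only a partial isometry;
    this avoids completing a basis and works for all [m] and [n]. *)
Lemma svd m n (Z : 'M[C]_(m, n)) : 
  exists (U : 'M[C]_(m, n)) (V : 'M[C]_n),
  [/\ contr U, unitary_mx V, Z = U *m rdiag n (ev (svals Z)) *m V^H &
      U^H *m Z *m V = rdiag n (ev (svals Z))].
Proof.
have hZ : herm_mx (Z^H *m Z) by rewrite /herm_mx hadjM hadjK.
have [V uV ZE] := spectral_perm hZ (perm_refl _).
set l := eigvals _ in ZE; set s := ev (svals Z).
have uV' := mulmx1C uV.
have ZV : (Z *m V)^H *m (Z *m V) = rdiag n (ev l).
  rewrite hadjM -mulmxA (mulmxA Z^H) ZE -!mulmxA uV mulmx1 mulmxA.
  by rewrite uV mul1mx.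
have l0 i : (i < n)%N -> 0 <= ev l i by move/gram_rdiag_ge0 => /(_ _ _ _ ZV).
have s2 i : (i < n)%N -> ev l i = s i * s i.
  by move=> /l0 h; rewrite /s /svals -svals_ev -expr2 sqr_sqrtr.
(* Since the inverse of 0 is 0, [e] is the indicator of the nonzero singular values. *)
pose t i := (s i)^-1; pose e i := t i * s i.
have eE i : e i = (s i != 0)%:R.
  by rewrite /e /t; case: eqP => [->|/eqP a0]; rewrite ?mulr0 ?mulVf.
have ee i : e i * e i = e i by rewrite eE -natrM mulnb andbb.
have se i : e i * s i = s i.
  by rewrite eE; case: eqP => [->|]; rewrite ?mul0r ?mul1r.
have UZV : (Z *m V *m rdiag n t)^H *m (Z *m V) = rdiag n s.
  rewrite hadjM hadj_rdiag -mulmxA ZV rdiagM; apply: eq_rdiag => i /s2 ->.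
  by rewrite mulrA -/(e i) se.
have UU : (Z *m V *m rdiag n t)^H *m (Z *m V *m rdiag n t) = rdiag n e.
  rewrite [X in X *m _ = _]/= mulmxA UZV rdiagM; apply: eq_rdiag => i _.
  by rewrite mulrC.
(* The two sides differ by the columns of [Z *m V] whose singular value is zero, and these have zero
   norm. *)
have ZVE : Z *m V *m rdiag n t *m rdiag n s = Z *m V.
  apply/esym/eqP; rewrite -subr_eq0; apply/eqP/nF_eq0.
  rewrite -mulmxA rdiagM -{1}[Z *m V]mulmx1 -rdiag1 -mulmxBr.
  rewrite rdiagN rdiagD /nF hadjM -mulmxA (mulmxA (Z *m V)^H) ZV.
  rewrite hadj_rdiag !rdiagM.
  rewrite (@eq_rdiag _ _ _ (fun=> 0)) => [|i /s2 ->]; last first.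
    rewrite -/(e i); have := se i; move: (e i) (s i) => x y xy.
    by rewrite (_ : _ * _ = (y - x * y) ^+ 2); [rewrite xy subrr expr0n|ring].
  by rewrite rdiag_const scale0r /retr mxtrace0.
exists (Z *m V *m rdiag n t), V; split=> //.
(* [U^H *m U] is the projection [rdiag n e], so [nF (U *m x)] equals [nF (rdiag n e *m x)]. *)
- move=> q x; rewrite /nF hadjM -mulmxA (mulmxA (_ *m rdiag n t)^H) UU.
  rewrite -(eq_rdiag (fun i _ => ee i)) -rdiagM -mulmxA mulmxA.
  rewrite -{1}hadj_rdiag -hadjM; apply: contr_rdiag => i _.
  by rewrite eE; case: eqP; rewrite /= ?normr0 ?normr1.
- by rewrite ZVE -mulmxA uV' mulmx1.
- by rewrite -mulmxA.
Qed.

End Spectral.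

(** * Ky Fan's principle and the spectral spread *)

Section KyFan.
Variable R : realType.
Local Notation C := R[i].

Lemma retr_rdiag_le n q (a b : nat -> R) (G : 'M[C]_(n, q)) :
  (forall i, (i < n)%N -> a i <= b i) ->
  retr (G^H *m rdiag n a *m G) <= retr (G^H *m rdiag n b *m G).
Proof.
move=> ab; rewrite -!mulmxA ![retr (G^H *m _)]retrC -!mulmxA !retr_rdiag.
apply: ler_sum => i _; rewrite ler_wpM2r ?ab //.
by rewrite Re_ge0 // mxE sumr_ge0 // => j _; rewrite !mxE mul_conjC_ge0.
Qed.

Lemma sum_ev_min (l : seq R) n r : (size l <= n)%N ->
  \sum_(i < minn n r) ev l i = \sum_(i < r) ev l i.
Proof.
move=> ln; case: (leqP n r) => // nr.
rewrite -(subnKC nr) big_split_ord /= [X in _ + X]big1 ?addr0 // => i _.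
by rewrite /ev nth_default //= (leq_trans ln) ?leq_addr.
Qed.

Lemma sort_dec_sorted (l : seq R) : sorted (fun a b : R => b <= a) (sort_dec l).
Proof. by apply: sort_sorted => x y; exact: le_total. Qed.

Lemma ev_sorted (l : seq R) i j : sorted (fun a b : R => b <= a) l ->
  (i <= j < size l)%N -> ev l j <= ev l i.
Proof.
move=> sl /andP[ij jl].
apply: (sorted_leq_nth (leT := fun a b : R => b <= a)) => //.
- by move=> x y z yx zy; exact: le_trans zy yx.
- by rewrite inE (leq_ltn_trans ij).
Qed.

Lemma ev_eigvals_le n (A : 'M[C]_n) i j : (i <= j < n)%N ->
  ev (eigvals A) j <= ev (eigvals A) i.
Proof.
by move=> ij; apply: ev_sorted; rewrite ?size_eigvals //; apply: sort_dec_sorted.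
Qed.

Lemma size_svals m n (Z : 'M[C]_(m, n)) : size (svals Z) = n.
Proof. by rewrite size_map size_eigvals. Qed.

Lemma ev_svals_ge0 m n (Z : 'M[C]_(m, n)) i : 0 <= ev (svals Z) i.
Proof. by rewrite -svals_ev sqrtr_ge0. Qed.

Lemma ev_svals_nonincr m n (Z : 'M[C]_(m, n)) i :
  ev (svals Z) i.+1 <= ev (svals Z) i.
Proof.
have [il|il] := ltnP i.+1 n; last first.
  by rewrite [leLHS]nth_default ?size_svals ?ev_svals_ge0.
by rewrite -!svals_ev ler_wsqrtr // ev_eigvals_le // leqnSn.
Qed.

Lemma contr_trace_le m n q (U : 'M[C]_(m, n)) l (P : 'M[C]_(m, q)) (Q : 'M[C]_(n, q)) :
  contr U -> frame l P -> frame l Q ->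
  retr (P^H *m U *m Q) <= \sum_(i < l) (1 : R).
Proof.
move=> cU [_ fP] [_ fQ]; rewrite sumr_const card_ord.
have := retr_le_nF P (U *m Q); have := cU _ Q; rewrite mulmxA; lra.
Qed.

(** Insert the singular value decomposition: the singular values become the weights of
    [weighted_trace], [U] is the matrix bounded there with [g = 1], and [V^H] is absorbed into
    [Q]. *)
Lemma kyfan_le m n q r (Z : 'M[C]_(m, n)) (P : 'M[C]_(m, q)) (Q : 'M[C]_(n, q)) :
  frame r P -> frame r Q ->
  retr (P^H *m Z *m Q) <= \sum_(i < r) ev (svals Z) i.
Proof.
move=> fP fQ; have [U [V [cU uV ZE _]]] := svd Z.
rewrite [in leLHS]ZE !mulmxA -mulmxA.
have -> : \sum_(i < r) ev (svals Z) i = \sum_(i < r) ev (svals Z) i * 1.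
  by apply: eq_bigr => i _; rewrite mulr1.
apply: (weighted_trace (g := fun=> 1)) => //.
- exact: ev_svals_nonincr.
- exact: ev_svals_ge0.
- by move=> l p P' Q'; apply: contr_trace_le.
- by apply: frameM_l => //; apply/contr_hadj/contr_isom.
Qed.

(** The witnesses are the first [r] left and right singular vectors, padded by zero columns; for
    [r > n] the truncation is void and the extra terms of the sum are zero. *)
Lemma kyfan_attained m n r (Z : 'M[C]_(m, n)) :
  exists (P : 'M[C]_(m, n)) (Q : 'M[C]_n),
    [/\ frame r P, frame r Q &
        retr (P^H *m Z *m Q) = \sum_(i < r) ev (svals Z) i].
Proof.
have [U [V [cU uV _ UZV]]] := svd Z; have fr := frame_below R n r.
exists (U *m rdiag n (below R r)), (V *m rdiag n (below R r)); split.
- exact: frameM_l.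
- by apply: frameM_l => //; apply: contr_isom.
rewrite hadjM hadj_rdiag -!mulmxA (mulmxA Z) (mulmxA U^H) (mulmxA U^H) UZV.
rewrite retrC -mulmxA below_idem retrC retr_rdiag.
rewrite (eq_bigr (fun i : 'I_n => below R r i * ev (svals Z) i)); last first.
  by move=> i _; rewrite !mxE eqxx.
by rewrite sum_below sum_ev_min // size_svals.
Qed.

(** Frames only bound [nF G] from above, so the weights must be non-negative: the spectrum is
    shifted by [mu], then dominated by the non-negative [f]. The term [mu * nF G] is kept explicit
    so that it can cancel later. *)
Lemma hermitian_trace_le n q (V : 'M[C]_n) (a f : nat -> R) mu l
    (G : 'M[C]_(n, q)) :
  unitary_mx V -> frame l G ->
  (forall i, f i.+1 <= f i) -> (forall i, 0 <= f i) ->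
  (forall i, (i < n)%N -> a i - mu <= f i) ->
  retr (G^H *m (V *m rdiag n a *m V^H) *m G) - mu * nF G <= \sum_(i < l) f i.
Proof.
move=> uV fG fd f0 af; have uV' := mulmx1C uV.
have -> : retr (G^H *m (V *m rdiag n a *m V^H) *m G) - mu * nF G =
    retr ((V^H *m G)^H *m rdiag n (fun i => a i - mu) *m (V^H *m G)).
  rewrite -[rdiag n (fun _ => _ - _)]rdiagD -[rdiag n (fun=> - mu)]rdiagN.
  rewrite rdiag_const hadjM hadjK mulmxDr mulmxDl mulmxN mulNmx retrB !mulmxA.
  congr (_ - _); rewrite -scalemxAr -!scalemxAl retrZ mulmx1.
  by rewrite /nF -(mulmxA G^H) uV' mulmx1.
apply: le_trans (retr_rdiag_le _ af) _.
rewrite hadjM hadjK.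
have -> : \sum_(i < l) f i = \sum_(i < l) f i * 1.
  by apply: eq_bigr => i _; rewrite mulr1.
apply: (weighted_trace (g := fun=> 1)) => //.
- by move=> k p P' Q'; apply: contr_trace_le; apply: contr_isom.
- by apply: frameM_l => //; apply/contr_hadj/contr_isom.
Qed.

Lemma ev_spr n (A : 'M[C]_n) i :
  ev (spr A) i = if (i < n./2)%N
                 then ev (eigvals A) i - ev (eigvals A) (n - i.+1) else 0.
Proof.
rewrite /ev /spr; case: ltnP => ih; last by rewrite nth_default // size_map size_iota.
by rewrite (nth_map 0%N) ?size_iota // nth_iota.
Qed.

(* The orthogonality of [P] and [Q] makes [(P + Q) / sqrt 2] and
   [(P - Q) / sqrt 2] contractions with the same Frobenius norm, so that [A] may
   be shifted by its median eigenvalue before their quadratic forms are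
   compared. *)
Lemma spread_trace_le n q (A : 'M[C]_n) l (P Q : 'M[C]_(n, q)) :
  herm_mx A -> frame l P -> frame l Q -> P^H *m Q = 0 ->
  retr (P^H *m A *m Q) *+ 2 <= \sum_(i < l) ev (spr A) i.
Proof.
move=> hA [cP fP] [cQ fQ] PQ.
pose lam := ev (eigvals A); pose h := n./2; pose mu := lam h.
have lamE i j : (i <= j < n)%N -> lam j <= lam i by exact: ev_eigvals_le.
(* [f] and [f'] are the parts of the spectrum above and below the median, the latter read from the
   bottom; [f i + f' i] is entry [i] of the spread. *)
pose f i := if (i < h)%N then lam i - mu else 0.
pose f' i := if (i < h)%N then mu - lam (n - i.+1)%N else 0.
have fle i : (i < n)%N -> lam i - mu <= f i.
  move=> il; rewrite /f; case: ltnP => // ih.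
  by rewrite subr_le0 lamE // ih.
have f'le i : (i < n)%N -> - lam (n - i.+1)%N - - mu <= f' i.
  move=> il; rewrite /f'; case: ltnP => ih; first by rewrite opprK addrC.
  by rewrite opprK addrC subr_le0 lamE // /h; rewrite /h in ih; lia.
have f0 i : 0 <= f i.
  by rewrite /f; case: ltnP => // ih; rewrite subr_ge0 lamE // /h; rewrite /h in ih; lia.
have f'0 i : 0 <= f' i.
  by rewrite /f'; case: ltnP => // ih; rewrite subr_ge0 lamE // /h; rewrite /h in ih; lia.
have fd i : f i.+1 <= f i.
  rewrite {1}/f; case: ltnP => // ih; rewrite /f ltnW // lerD2r lamE //.
  by rewrite /h in ih; lia.
have f'd i : f' i.+1 <= f' i.
  rewrite {1}/f'; case: ltnP => // ih; rewrite /f' ltnW // lerD2l lerN2 lamE //.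
  by rewrite /h in ih; lia.
have [V uV AE] := spectral_perm hA (perm_refl _).
(* With the eigenvalues of [A] in increasing order, those of [- A] come out non-increasing, as [f']
   requires. *)
have [V' uV' AE'] : exists2 V', unitary_mx V' &
    A = V' *m rdiag n (fun i => lam (n - i.+1)%N) *m V'^H.
  have [|V' uV' {}AE] := @spectral_perm _ _ A (rev (eigvals A)) hA.
    by rewrite perm_rev.
  exists V' => //; rewrite [LHS]AE; congr (_ *m _ *m _); apply: eq_rdiag => i il.
  by rewrite /ev nth_rev size_eigvals.
pose c : R := (Num.sqrt 2)^-1.
have c2 : c ^+ 2 = 2^-1 by rewrite /c exprVn sqr_sqrtr.
have QP : Q^H *m P = 0 by rewrite -[P]hadjK -hadjM PQ hadj0.
pose G e := rcplx c *: (P + rcplx e *: Q).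
have nG e q' (x : 'M_(q, q')) : e ^+ 2 = 1 ->
    nF (G e *m x) = (nF (P *m x) + nF (Q *m x)) / 2.
  move=> e2; rewrite /G -scalemxAl nFZ c2 mulmxDl -scalemxAl nFD nFZ e2 mul1r.
  rewrite hadjM -scalemxAr -mulmxA (mulmxA P^H) PQ mul0mx mulmx0 scaler0.
  by rewrite /retr mxtrace0 /= mul0rn addr0 mulrC.
have nG1 e : e ^+ 2 = 1 -> nF (G e) = (nF P + nF Q) / 2.
  by move=> e2; have := nG e _ 1%:M e2; rewrite !mulmx1.
have fG e : e ^+ 2 = 1 -> frame l (G e).
  move=> e2; split; last by rewrite nG1 //; lra.
  by move=> q' x; rewrite nG //; have := cP _ x; have := cQ _ x; lra.
have qG e : e ^+ 2 = 1 -> retr ((G e)^H *m A *m G e) =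
    (retr (P^H *m A *m P) + retr (Q^H *m A *m Q) + e * retr (P^H *m A *m Q) *+ 2) / 2.
  move=> e2; rewrite /G hadjZ -!scalemxAl -scalemxAr !retrZ mulrA -expr2 c2.
  rewrite hadjD hadjZ !(mulmxDl, mulmxDr) !retrD -!scalemxAl -!scalemxAr -?scalemxAl !retrZ.
  rewrite -[retr (Q^H *m A *m P)]retr_hadj !hadjM hadjK hA mulmxA.
  by rewrite mulrA -expr2 e2; ring.
have e1 : (1 : R) ^+ 2 = 1 by rewrite expr1n.
have e2 : (-1 : R) ^+ 2 = 1 by rewrite sqrrN expr1n.
(* Bound [A] on [G 1] and [- A] on [G (-1)]. In the sum the terms in [P] alone and [Q] alone cancel,
   as do the shifts, because both frames have the same [nF]; the cross terms add up to twice the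
   trace. *)
have := hermitian_trace_le uV (fG 1 e1) fd f0 fle.
rewrite -AE qG // nG1 //.
have NA : - A = V' *m rdiag n (fun i => - lam (n - i.+1)%N) *m V'^H.
  by rewrite -rdiagN mulmxN mulNmx -AE'.
have := hermitian_trace_le uV' (fG (-1) e2) f'd f'0 f'le.
rewrite -NA mulmxN mulNmx retrN qG // nG1 //.
have -> : \sum_(i < l) ev (spr A) i = \sum_(i < l) f i + \sum_(i < l) f' i.
  rewrite -big_split; apply: eq_bigr => i _.
  by rewrite ev_spr /f /f' /h /lam /=; case: ltnP => _; ring.
lra.
Qed.

End KyFan.

(** * Principal angles and half rotations *)

Section Rotation.
Variable R : realType.
Local Notation C := R[i].

Lemma sin_le_id (x : R) : 0 <= x -> sin x <= x.
Proof.
move=> x0.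
have sc : ({within `[0, x], continuous sin})%classic.
  by apply: continuous_subspaceT => y; exact: continuous_sin.
have [c _] := MVT_segment x0 (fun y _ => is_derive_sin y) sc.
rewrite sin0 !subr0 => ->; rewrite -[leRHS]mul1r ler_wpM2r //.
exact: cos_le1.
Qed.

Lemma acos_nonincr (x y : R) : -1 <= x -> x <= y -> y <= 1 -> acos y <= acos x.
Proof.
move=> x1 xy y1; have xI : -1 <= x <= 1 by rewrite x1 (le_trans xy).
have yI : -1 <= y <= 1 by rewrite y1 (le_trans x1).
rewrite leNgt; apply/negP => h.
have := @ltr_cos R (acos x) (acos y); rewrite !in_itv /= !acos_ge0 // !acos_lepi //.
move=> /(_ isT isT) e.
by rewrite -e !acosK ?in_itv //= ltNge xy in h.
Qed.

Lemma ev_svals_le1 m n (Z : 'M[C]_(m, n)) i : contr Z -> ev (svals Z) i <= 1.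
Proof.
move=> cZ; have [P [Q [[_ fP] [_ fQ] e]]] := kyfan_attained 1 Z.
have {e}: ev (svals Z) 0 <= 1.
  rewrite big_ord1 in e; rewrite -e.
  by have := retr_le_nF P (Z *m Q); have := cZ _ Q; rewrite mulmxA; lra.
elim: i => // i IH h0; exact: le_trans (ev_svals_nonincr _ _) (IH h0).
Qed.

Lemma ev_angles d k (X Y : 'M[C]_(d, k)) i : 
  ev (angles X Y) i =
  if (i < k)%N then acos (ev (svals (X^H *m Y)) (k - i.+1)) else 0.
Proof.
rewrite /ev /angles; case: ltnP => ik; last first.
  by rewrite nth_default // size_map size_rev size_svals.
by rewrite (nth_map 0) ?size_rev ?size_svals // nth_rev ?size_svals.
Qed.

Section Angles.
Variables (d k : nat) (X Y : 'M[C]_(d, k)).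
Hypotheses (iX : isom_mx X) (iY : isom_mx Y).

Let cXY : contr (X^H *m Y).
Proof. by apply: contrM; [apply/contr_hadj|]; apply: contr_isom. Qed.

Let s01 i : -1 <= ev (svals (X^H *m Y)) i <= 1.
Proof. by rewrite ev_svals_le1 // (le_trans _ (ev_svals_ge0 _ _)) ?lerN10. Qed.

Lemma ev_angles_ge0 i : 0 <= ev (angles X Y) i.
Proof. by rewrite ev_angles; case: ltnP => // _; apply: acos_ge0. Qed.

Lemma ev_angles_le_pi i : ev (angles X Y) i <= pi.
Proof.
by rewrite ev_angles; case: ltnP => _; rewrite ?pi_ge0 // acos_lepi.
Qed.

Lemma ev_angles_nonincr i : ev (angles X Y) i.+1 <= ev (angles X Y) i.
Proof.
rewrite [leLHS]ev_angles; case: ltnP => ik; last exact: ev_angles_ge0.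
rewrite ev_angles ltnW //; apply: acos_nonincr.
- by case/andP: (s01 (k - i.+1)).
- rewrite (_ : (k - i.+1 = (k - i.+2).+1)%N); last by lia.
  exact: ev_svals_nonincr.
- by case/andP: (s01 (k - i.+2)).
Qed.

End Angles.

Lemma ev_spr_ge0 n (A : 'M[C]_n) i : 0 <= ev (spr A) i.
Proof.
rewrite ev_spr; case: ltnP => // ih; rewrite subr_ge0 ev_eigvals_le //.
by lia.
Qed.

Lemma ev_spr_nonincr n (A : 'M[C]_n) i : ev (spr A) i.+1 <= ev (spr A) i.
Proof.
rewrite [leLHS]ev_spr; case: ltnP => ih; last exact: ev_spr_ge0.
by rewrite ev_spr ltnW // lerB // ev_eigvals_le //; lia.
Qed.

(** The terms in [a] alone and [b] alone cancel, leaving [-2] times [a^H *m A *m b] plus its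
    adjoint. Under the real trace, taking the adjoint exchanges [P] and [Q], so one estimate will
    serve for both terms. *)
Lemma polar_trace d k q (A : 'M[C]_d) (F G a b : 'M[C]_(d, k))
    (P Q : 'M[C]_(k, q)) :
  herm_mx A -> F = a - b -> G = a + b ->
  retr (P^H *m (F^H *m A *m F - G^H *m A *m G) *m Q) =
  - (retr (P^H *m (a^H *m A *m b) *m Q) *+ 2 +
     retr (Q^H *m (a^H *m A *m b) *m P) *+ 2).
Proof.
move=> hA -> ->.
have polar (p x y z : 'M[C]_k) :
    p - x - (y - z) - (p + x + (y + z)) = - ((x + y) + (x + y)).
  rewrite opprB addrACA -opprD (addrC y z) (addrACA p x).
  by move: (p + z) (x + y) => u v; rewrite opprD addrACA subrr add0r -opprD.
have -> : (a - b)^H *m A *m (a - b) - (a + b)^H *m A *m (a + b) =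
    - ((a^H *m A *m b + b^H *m A *m a) + (a^H *m A *m b + b^H *m A *m a)).
  by rewrite hadjB hadjD !mulmxBl !mulmxDl !mulmxBr !mulmxDr polar.
have -> : retr (Q^H *m (a^H *m A *m b) *m P) = retr (P^H *m (b^H *m A *m a) *m Q).
  by rewrite -retr_hadj !hadjM !hadjK hA !mulmxA.
move: (a^H *m A *m b) (b^H *m A *m a) => M N.
rewrite mulmxN mulNmx retrN !mulmxDr !mulmxDl !retrD.
by rewrite !mulr2n addrACA.
Qed.

(* [E] and [E'] are the images of [F] and [F'] under the rotation by half the
   angles; [F] and [U F] are its backward and forward rotations, so that the
   difference of the two compressions of [A] only involves [E^H A E'], with the
   factor [sin (theta / 2)]. *)
Lemma rotation_trace_le d k q (A U : 'M[C]_d) (F F' : 'M[C]_(d, k))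
    (th : nat -> R) r (P Q : 'M[C]_(k, q)) :
  let sn i := sin (th i / 2) in
  herm_mx A -> (forall i, 0 <= th i) -> (forall i, th i <= pi) ->
  (forall i, th i.+1 <= th i) ->
  isom_mx F -> F^H *m F' = 0 -> contr F' ->
  F'^H *m F' *m rdiag k sn = rdiag k sn ->
  U *m F = F *m rdiag k (cos \o th) + F' *m rdiag k (sin \o th) ->
  frame r P -> frame r Q ->
  retr (P^H *m (F^H *m A *m F - (U *m F)^H *m A *m (U *m F)) *m Q) <=
  \sum_(i < r) th i * ev (spr A) i.
Proof.
move=> sn hA th0 thpi thd iF FF' cF' F's UF fP fQ.
pose cs i := cos (th i / 2); pose S := rdiag k sn; pose K := rdiag k cs.
have F'F : F'^H *m F = 0 by rewrite -[F]hadjK -hadjM FF' hadj0.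
(* Columns of angle zero may have no partner in [F'], so its Gram matrix need not be the identity;
   next to [S] it acts as one. *)
have sF' : S *m (F'^H *m F') = S.
  by rewrite -{2}[S]hadj_rdiag -F's !hadjM hadjK hadj_rdiag.
have cs2 i : cs i * cs i + sn i * sn i = 1 by rewrite -!expr2 cos2Dsin2.
have KS : K *m S = S *m K by rewrite !rdiagM; apply: eq_rdiag => i _; rewrite mulrC.
have KKSS : K *m K + S *m S = 1%:M.
  by rewrite !rdiagM rdiagD -rdiag1; apply: eq_rdiag.
have hS : S^H = S by exact: hadj_rdiag.
have hK : K^H = K by exact: hadj_rdiag.
pose E := F *m K + F' *m S; pose E' := F' *m K - F *m S.
pose a := E *m K; pose b := E' *m S; pose M := a^H *m A *m b.
have EF : F = a - b.
  rewrite /a /b /E /E' mulmxDl mulmxBl -!mulmxA KS opprB addrACA.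
  by rewrite subrr addr0 -mulmxDr KKSS mulmx1.
have EUF : U *m F = a + b.
  rewrite UF /a /b /E /E' mulmxDl mulmxBl -!mulmxA -KS.
  rewrite [X in _ = _ + X]addrC addrACA -mulmxBr -mulmxDr; congr (_ + _); congr (_ *m _).
    rewrite !rdiagM rdiagN rdiagD; apply: eq_rdiag => i _ /=.
    by rewrite {1}(splitr (th i)) cosD.
  rewrite !rdiagM rdiagD; apply: eq_rdiag => i _ /=.
  by rewrite {1}(splitr (th i)) sinD mulrC.
have iE : isom_mx E.
  rewrite /isom_mx /E hadjD !hadjM hS hK mulmxDl !mulmxDr -!mulmxA.
  rewrite (mulmxA F^H) iF mul1mx (mulmxA F^H F') FF' mul0mx mulmx0 addr0.
  rewrite (mulmxA F'^H F) F'F mul0mx mulmx0 add0r (mulmxA F'^H F').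
  by rewrite (mulmxA S (F'^H *m F')) sF'.
have EE' : E^H *m E' = 0.
  rewrite /E /E' hadjD !hadjM hS hK mulmxDl !mulmxBr -!mulmxA.
  rewrite (mulmxA F^H F') FF' mul0mx mulmx0 sub0r (mulmxA F^H F) iF mul1mx.
  rewrite (mulmxA F'^H F) F'F mul0mx mulmx0 subr0 (mulmxA F'^H F').
  by rewrite (mulmxA S (F'^H *m F')) sF' KS addNr.
(* [E'] need not be an isometry, but its two terms have orthogonal ranges, so the squared norms add
   to at most [nF (K *m x) + nF (S *m x) = nF x]. *)
have cE' : contr E'.
  move=> p x; rewrite /E' mulmxBl nFB -!mulmxA hadjM -!mulmxA (mulmxA F'^H F) F'F.
  rewrite mul0mx mulmx0 /retr mxtrace0 mul0rn subr0.
  apply: le_trans (lerD (cF' _ _) (contr_isom iF _)) _.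
  rewrite /nF !hadjM hK hS -retrD -!mulmxA -mulmxDr (mulmxA K) (mulmxA S).
  by rewrite -mulmxDl KKSS mul1mx.
have cK : contr K.
  by apply: contr_rdiag => i _; rewrite ler_norml cos_geN1 cos_le1.
(* The half angles lie between 0 and [pi / 2], where sine is non-negative and increasing; this makes
   [sn] an admissible weight. *)
have sn0 i : 0 <= sn i.
  apply: sin_ge0_pi; have := th0 i; have := thpi i; lra.
have snd i : sn i.+1 <= sn i.
  rewrite leNgt ltr_sin ?in_itv /=.
  - by rewrite -leNgt; have := thd i; lra.
  - by have := th0 i; have := thpi i; lra.
  - by have := th0 i.+1; have := thpi i.+1; lra.
(* Each of the two terms from [polar_trace] contributes half of the bound. The sign and the factor
   [K] are absorbed into the left frame, while [S] on the right supplies the weights. *)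
have key p (P' Q' : 'M_(k, p)) : frame r P' -> frame r Q' ->
    - (retr (P'^H *m M *m Q') *+ 2) <=
    \sum_(i < r) th i / 2 * ev (spr A) i.
  move=> fP' fQ'.
  have -> : P'^H *m M *m Q' = - ((- (K *m P'))^H *m (E^H *m A *m E') *m S *m Q').
    by rewrite /M /a /b hadjN !hadjM !mulNmx opprK !mulmxA.
  rewrite retrN mulNrn opprK.
  apply: le_trans (_ : (\sum_(i < r) sn i * (ev (spr A) i / 2)) *+ 2 <= _).
    rewrite lerMn2r /=; apply: (weighted_trace (s := sn) (g := fun i => ev (spr A) i / 2)) => //.
    - by move=> i; rewrite divr_ge0 // ev_spr_ge0.
    - move=> l p' P'' Q'' fP'' fQ''.
      have := @spread_trace_le _ _ _ A l (E *m P'') (E' *m Q'') hA.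
      rewrite -mulr_suml ler_pdivlMr // mulr_natr !hadjM !mulmxA; apply.
      + exact: frameM_l (contr_isom iE) fP''.
      + exact: frameM_l cE' fQ''.
      + by rewrite -(mulmxA P''^H) EE' mulmx0 mul0mx.
    - by apply: frameN; apply: frameM_l.
  rewrite -sumrMnl; apply: ler_sum => i _.
  have -> : sn i * (ev (spr A) i / 2) *+ 2 = sn i * ev (spr A) i by field.
  rewrite ler_wpM2r ?ev_spr_ge0 // sin_le_id // divr_ge0 //.
have -> : \sum_(i < r) th i * ev (spr A) i =
    \sum_(i < r) th i / 2 * ev (spr A) i + \sum_(i < r) th i / 2 * ev (spr A) i.
  by rewrite -big_split; apply: eq_bigr => i _ /=; field.
rewrite (polar_trace P Q hA EF EUF).
have := lerD (key _ _ _ fP fQ) (key _ _ _ fQ fP).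
by rewrite -opprD.
Qed.

End Rotation.

(** * Direct rotations *)

Section Geometry.
Variable R : realType.
Local Notation C := R[i].

Lemma trmx_perp d m n (V : 'M[C]_(d, m)) (W : 'M[C]_(d, n)) :
  (V^T <= perp W^T)%MS -> W^H *m V = 0.
Proof.
by move=> /sub_kermxP/(congr1 trmx); rewrite trmx_mul trmx0 trmxK /hadj trmxK map_trmx.
Qed.

Lemma isom_row_mx d m n (A : 'M[C]_(d, m)) (B : 'M[C]_(d, n)) :
  isom_mx (row_mx A B) <-> [/\ isom_mx A, isom_mx B & A^H *m B = 0].
Proof.
rewrite /isom_mx hadj_row_mx mul_col_row scalar_mx_block; split.
  by case/eq_block_mx => -> -> _ ->.
by case=> -> -> AB; rewrite AB -[B^H *m A]hadjK hadjM hadjK AB hadj0.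
Qed.

(** The factor is [W^H *m X]. The sizes [k] and [l] stay distinct because their equality is deduced
    from the two identities, in [isom_cols]. *)
Lemma isom_factor d k l (X : 'M[C]_(d, k)) (W : 'M[C]_(d, l)) :
  isom_mx X -> isom_mx W -> (X^T == W^T)%MS ->
  exists2 Q : 'M[C]_(l, k), X = W *m Q & Q^H *m Q = 1%:M /\ Q *m Q^H = 1%:M.
Proof.
move=> iX iW /andP[/submxP[D XD] /submxP[D' WD]].
have XW : X = W *m D^T by rewrite -[X]trmxK XD trmx_mul trmxK.
have WX : W = X *m D'^T by rewrite -[W]trmxK WD trmx_mul trmxK.
have DE : D^T = W^H *m X by rewrite [in RHS]XW mulmxA iW mul1mx.
exists D^T => //; split.
  by rewrite -iX [in RHS]XW hadjM -mulmxA (mulmxA W^H) iW mul1mx.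
rewrite DE hadjM hadjK -mulmxA {2}WX (mulmxA X^H) iX mul1mx.
by rewrite -WX.
Qed.

Lemma isom_cols d k l (X : 'M[C]_(d, k)) (W : 'M[C]_(d, l)) :
  isom_mx X -> isom_mx W -> (X^T == W^T)%MS -> k = l.
Proof.
move=> iX iW XW; have [Q _ [/mulmx1_min kl /mulmx1_min lk]] := isom_factor iX iW XW.
by apply/eqP; rewrite eqn_leq kl lk.
Qed.

Lemma rdiag_block m n (f : nat -> R) :
  rdiag (m + n) f = block_mx (rdiag m f) 0 0 (rdiag n (fun i => f (m + i)%N)).
Proof.
rewrite -diag_mx_row; congr diag_mx; apply/rowP => i; rewrite !mxE.
by case: splitP => j ->; rewrite mxE.
Qed.

Lemma sort_dec_cat_ones (e : seq R) n :
  sorted (fun a b : R => b <= a) e -> (forall x, x \in e -> x <= 1) ->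
  sort_dec (e ++ nseq n 1) = nseq n 1 ++ e.
Proof.
move=> se e1; have tr : transitive (fun a b : R => b <= a).
  by move=> x y z yx zy; exact: le_trans zy yx.
have -> : sort_dec (e ++ nseq n 1) = sort_dec (nseq n 1 ++ e).
  apply/perm_sortP => //.
  - by move=> x y; exact: le_total.
  - by move=> x y /andP[yx xy]; apply: le_anti; rewrite yx xy.
  - by rewrite perm_catC.
apply: sorted_sort => //; rewrite sorted_pairwise // pairwise_cat.
apply/and3P; split; last by rewrite -sorted_pairwise.
  by apply/allrelP => x y /nseqP[-> _] /e1.
elim: n => //= n ->; rewrite andbT; apply/allP => x /nseqP[-> _].
exact: lexx.
Qed.

(** Up to unitaries the matrix of cosines is block diagonal, with blocks [W1^H *m V1] and the
    identity. The first block is a contraction, so the [n] ones lead the singular values and, after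
    reversal, give the zero angles at the end. *)
Lemma angles_common d m n (W1 V1 : 'M[C]_(d, m)) (W0 : 'M[C]_(d, n))
    (Q Q' : 'M[C]_(m + n)) :
  isom_mx (row_mx W1 W0) -> isom_mx (row_mx V1 W0) ->
  unitary_mx Q -> unitary_mx Q' ->
  angles (row_mx W1 W0 *m Q) (row_mx V1 W0 *m Q') =
  angles W1 V1 ++ nseq n 0.
Proof.
move=> /isom_row_mx[iW1 iW0 W10] /isom_row_mx[iV1 _ V10] uQ uQ'.
pose T := W1^H *m V1.
have cT : contr T by apply: contrM; [apply/contr_hadj|]; apply: contr_isom.
have hT : herm_mx (T^H *m T) by rewrite /herm_mx hadjM hadjK.
have [V uV TV] := spectral_perm hT (perm_refl _).
set e := eigvals _ in TV.
have se : sorted (fun a b : R => b <= a) e by exact: sort_dec_sorted.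
have e1 x : x \in e -> x <= 1.
  move=> /(nthP 0)[i _ <-]; have := ev_svals_le1 i cT; rewrite -svals_ev -/e.
  have [e0|e0 _] := leP 0 (nth 0 e i); last by rewrite ltW // (lt_le_trans e0).
  by rewrite -[X in _ <= X]sqrtr1 ler_sqrt.
have V01 : W0^H *m V1 = 0 by rewrite -[V1]hadjK -hadjM V10 hadj0.
pose Z := (row_mx W1 W0 *m Q)^H *m (row_mx V1 W0 *m Q').
have ZE : Z = Q^H *m block_mx T 0 0 1%:M *m Q'.
  rewrite /Z hadjM -mulmxA (mulmxA (row_mx _ _)^H) hadj_row_mx mul_col_row.
  by rewrite W10 V01 iW0 mulmxA.
have hblock (M : 'M[C]_m) : (block_mx M 0 0 (1%:M : 'M[C]_n))^H = block_mx M^H 0 0 1%:M.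
  by rewrite /hadj map_block_mx tr_block_mx !map_mx0 !trmx0 map_mx1 trmx1.
have EZ : eigvals (Z^H *m Z) = nseq n 1 ++ e.
  pose B := block_mx V 0 0 (1%:M : 'M[C]_n).
  have uB : unitary_mx (Q'^H *m B).
    rewrite /unitary_mx hadjM hadjK -mulmxA (mulmxA Q') (mulmx1C uQ') mul1mx.
    rewrite hblock mulmx_block !mul0mx !mulmx0 !mul1mx !addr0 add0r uV.
    by rewrite -scalar_mx_block.
  rewrite -sort_dec_cat_ones //; apply: (eigvals_diagonal _ uB).
    by rewrite size_cat size_nseq size_eigvals.
  have -> : rdiag (m + n) (ev (e ++ nseq n 1)) = block_mx (rdiag m (ev e)) 0 0 1%:M.
    rewrite rdiag_block -rdiag1; congr block_mx; apply: eq_rdiag => i ilt.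
      by rewrite /ev nth_cat size_eigvals ilt.
    by rewrite /ev nth_cat size_eigvals ltnNge leq_addr /= addKn nth_nseq ilt.
  rewrite ZE !hadjM !hadjK !hblock -!mulmxA (mulmxA Q) (mulmx1C uQ) mul1mx.
  congr (_ *m _); rewrite !mulmxA; congr (_ *m _).
  rewrite !mulmx_block !mul0mx !mulmx0 !mul1mx !mulmx1 !addr0 !add0r ?mul0mx ?mulmx0 ?addr0.
  by rewrite TV.
rewrite /angles /svals EZ map_cat map_nseq sqrtr1 rev_cat map_cat.
by rewrite rev_nseq map_nseq acos1.
Qed.

(** This passes from the block form of [U], whose angles are those between [S1] and [S3], to the
    angles of [X] and [Y] themselves; the two lists differ by zeros coming from the intersection. *)
Lemma direct_rotation_frames d k (X Y : 'M[C]_(d, k)) (U : 'M[C]_d) :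
  isom_mx X -> isom_mx Y -> direct_rotation X^T Y^T U ->
  let th := ev (angles X Y) in
  let S := rdiag k (fun i => sin (th i / 2)) in
  exists (F F' : 'M[C]_(d, k)) (Q : 'M[C]_k),
    [/\ unitary_mx Q, X = F *m Q, isom_mx F, F^H *m F' = 0 &
        [/\ contr F', F'^H *m F' *m S = S &
            U *m F = F *m rdiag k (cos \o th) + F' *m rdiag k (sin \o th)]].
Proof.
move=> iX iY [m0 [m [m3 [W0 [W1 [W2 [W3 [V1]]]]]]]].
case=> _ /isom_row_mx[/isom_row_mx[/isom_row_mx[iW0 iW1 W01] iW2 W012] _ _].
case=> [eW0 eW1 _ _] [iV1 eV1] [UW0 UW1 _ _].
have [XE YE V1W0] := two_subspaces eW0 eW1 eV1.
rewrite -tr_row_mx in XE; rewrite -tr_row_mx in YE.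
have W02 : W0^H *m W2 = 0 /\ W1^H *m W2 = 0.
  by move: W012; rewrite hadj_row_mx mul_col_mx -col_mx0 => /eq_col_mx[].
have iF : isom_mx (row_mx W1 W0).
  by apply/isom_row_mx; split=> //; rewrite -[W0]hadjK -hadjM W01 hadj0.
have iF2 : isom_mx (row_mx V1 W0).
  by apply/isom_row_mx; split=> //; rewrite -[W0]hadjK -hadjM trmx_perp ?hadj0.
have kE := isom_cols iX iF XE; subst k.
have [Q XQ [uQ _]] := isom_factor iX iF XE.
have [Q' YQ' [uQ' _]] := isom_factor iY iF2 YE.
have thE : angles X Y = angles W1 V1 ++ nseq m0 0.
  by rewrite XQ YQ'; exact: angles_common.
have th1 i : (i < m)%N -> ev (angles X Y) i = ev (angles W1 V1) i.
  by move=> im; rewrite thE /ev nth_cat size_map size_rev size_svals im.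
have th2 i : ev (angles X Y) (m + i)%N = 0.
  rewrite thE /ev nth_cat size_map size_rev size_svals ltnNge leq_addr /= addKn.
  by rewrite nth_nseq; case: ifP.
(* [U] fixes [W0], which gets zero partner columns: the corresponding angles are zero, so the sine
   factors vanish there. *)
exists (row_mx W1 W0), (row_mx W2 0), Q; split=> //.
  by rewrite hadj_row_mx mul_col_row !mulmx0; case: W02 => -> ->; exact: block_mx0.
split.
- move=> q x; rewrite -[x]vsubmxK mul_row_col mul0mx addr0.
  apply: le_trans (contr_isom iW2 _) _.
  by rewrite /nF /hadj map_col_mx tr_col_mx mul_row_col retrD lerDl nF_ge0.
- rewrite hadj_row_mx mul_col_row iW2 hadj0 !mul0mx !mulmx0 rdiag_block.
  rewrite mulmx_block !mul0mx !mulmx0 !mul1mx !addr0.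
  congr block_mx; rewrite -[0 in LHS](scale0r 1%:M) -[X in X *: _](rmorph0 (real_complex R)).
  by rewrite -rdiag_const; apply: eq_rdiag => i _; rewrite th2 mul0r sin0.
- rewrite mul_mx_row UW0 UW1 !rdiag_block !mul_row_block !mulmx0 !mul0mx !addr0 !add0r.
  rewrite add_row_mx; congr row_mx.
    have thW (f : R -> R) : rdiag m (f \o ev (angles W1 V1)) = rdiag m (f \o ev (angles X Y)).
      by apply: eq_rdiag => i im /=; rewrite th1.
    by rewrite -(thW (@cos R)) -(thW (@sin R)).
  rewrite addr0 -[LHS]mulmx1 -rdiag1; congr (_ *m _); apply: eq_rdiag => i _ /=.
  by rewrite th2 cos0.
Qed.

End Geometry.

(** * Submajorization through partial sums, and traces of compressions *)

Section Submajorization.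
Variable R : realType.
Local Notation C := R[i].

Lemma ev_padz n (s : seq R) i : ev (padz n s) i = ev s i.
Proof.
rewrite /ev nth_cat nth_nseq; case: ltnP => // si; rewrite (nth_default _ si).
by case: ifP.
Qed.

Lemma size_padz n (s : seq R) : (size s <= n)%N -> size (padz n s) = n.
Proof. by move=> sn; rewrite size_cat size_nseq subnKC. Qed.

Lemma ev_zip_padz (f : R -> R -> R) (x y : seq R) i : f 0 0 = 0 ->
  let n := maxn (size x) (size y) in
  ev [seq f p.1 p.2 | p <- zip (padz n x) (padz n y)] i = f (ev x i) (ev y i).
Proof.
move=> f0 n; have sx : size (padz n x) = n by rewrite size_padz // leq_maxl.
have sy : size (padz n y) = n by rewrite size_padz // leq_maxr.
have szip : size (zip (padz n x) (padz n y)) = n.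
  by rewrite size_zip sx sy minnn.
have [il|il] := ltnP i n.
  rewrite /ev (nth_map (0, 0)) ?szip // nth_zip ?sx ?sy //=.
  by rewrite -!/(ev _ _) !ev_padz.
rewrite {1}/ev nth_default ?size_map ?szip //.
by rewrite -(ev_padz n x) -(ev_padz n y) /ev !nth_default ?sx ?sy.
Qed.

Lemma ev_vadd (x y : seq R) i : ev (vadd x y) i = ev x i + ev y i.
Proof. by apply: ev_zip_padz; rewrite addr0. Qed.

Lemma ev_vmul (x y : seq R) i : ev (vmul x y) i = ev x i * ev y i.
Proof. by apply: ev_zip_padz; rewrite mulr0. Qed.

Lemma ev_vscale c (x : seq R) i : ev (vscale c x) i = c * ev x i.
Proof.
rewrite /ev /vscale; have [il|il] := ltnP i (size x); first by rewrite (nth_map 0).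
by rewrite !nth_default ?size_map ?mulr0.
Qed.

(** The hypothesis also covers indices past the end, where [ev] is zero; it thus forces non-negative
    entries, and the padding is already in place. *)
Lemma sort_dec_padz (x : seq R) n : (forall i, ev x i.+1 <= ev x i) ->
  sort_dec (padz n x) = padz n x.
Proof.
move=> xd; apply: sorted_sort; first by move=> a b c ba cb; exact: le_trans cb ba.
by apply/(sortedP 0) => i _; rewrite -!/(ev _ _) !ev_padz.
Qed.

Lemma submaj_nonincr (x y : seq R) :
  (forall i, ev x i.+1 <= ev x i) -> (forall i, ev y i.+1 <= ev y i) ->
  (forall r, \sum_(i < r) ev x i <= \sum_(i < r) ev y i) -> submaj x y.
Proof.
move=> xd yd xy n xs ys r _; rewrite {}/xs {}/ys !sort_dec_padz //.
rewrite (eq_bigr (fun i : 'I_r => ev x i)) => [|i _]; last exact: ev_padz.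
rewrite [leRHS](eq_bigr (fun i : 'I_r => ev y i)) => [|i _]; last exact: ev_padz.
exact: xy.
Qed.

Lemma compression_trace d k q (M N : 'M[C]_d) (X Y : 'M[C]_(d, k))
    (P Q : 'M[C]_(k, q)) :
  retr (P^H *m (X^H *m M *m X - Y^H *m N *m Y) *m Q) =
  retr ((X *m P)^H *m M *m (X *m Q)) - retr ((Y *m P)^H *m N *m (Y *m Q)).
Proof. by rewrite mulmxBr mulmxBl retrB !hadjM !mulmxA. Qed.

Lemma kyfan_compression_le d k q (M N : 'M[C]_d) (X : 'M[C]_(d, k)) r
    (P Q : 'M[C]_(k, q)) :
  contr X -> frame r P -> frame r Q ->
  retr ((X *m P)^H *m M *m (X *m Q)) - retr ((X *m P)^H *m N *m (X *m Q)) <=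
  \sum_(i < r) ev (svals (M - N)) i.
Proof.
move=> cX fP fQ; rewrite -retrB -mulmxBl -mulmxBr.
exact: kyfan_le (frameM_l cX fP) (frameM_l cX fQ).
Qed.

Lemma sum_mul_mean r (a b c : nat -> R) :
  \sum_(i < r) a i * (2^-1 * (b i + c i)) =
  (\sum_(i < r) a i * b i + \sum_(i < r) a i * c i) / 2.
Proof. by rewrite -big_split mulr_suml; apply: eq_bigr => i _ /=; ring. Qed.

(** In use [a] and [c] are the traces of [A] compressed to [X] and [Yr], and [b] and [e] those of
    [B]; [a - e] is half the sum of the four differences. *)
Lemma mean_le (a b c e s u v : R) :
  a - c <= u -> b - e <= v -> a - b <= s -> c - e <= s ->
  a - e <= s + (u + v) / 2.
Proof. lra. Qed.

(** The isometry [X] differs from the adapted frame [F] by a unitary, which is absorbed into [P] and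
    [Q]. *)
Lemma direct_rotation_trace_le d k q (A U : 'M[C]_d) (X Y : 'M[C]_(d, k)) r
    (P Q : 'M[C]_(k, q)) :
  herm_mx A -> isom_mx X -> isom_mx Y -> direct_rotation X^T Y^T U ->
  frame r P -> frame r Q ->
  retr ((X *m P)^H *m A *m (X *m Q)) -
    retr ((U *m X *m P)^H *m A *m (U *m X *m Q)) <=
  \sum_(i < r) ev (angles X Y) i * ev (spr A) i.
Proof.
move=> hA iX iY dU fP fQ.
have [F [F' [V [uV XE iF FF' [cF' F's UF]]]]] := direct_rotation_frames iX iY dU.
have fVP := frameM_l (contr_isom uV) fP; have fVQ := frameM_l (contr_isom uV) fQ.
have := rotation_trace_le hA (ev_angles_ge0 iX iY) (ev_angles_le_pi iX iY)
  (ev_angles_nonincr iX iY) iF FF' cF' F's UF fVP fVQ.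
have FX (Z : 'M[C]_(k, q)) : F *m (V *m Z) = X *m Z by rewrite XE mulmxA.
have UFX (Z : 'M[C]_(k, q)) : U *m F *m (V *m Z) = U *m X *m Z.
  by rewrite XE !mulmxA.
by rewrite compression_trace !FX !UFX.
Qed.

End Submajorization.
End DirectRotation.

Theorem theorem3p1 (R : realType) (d k : nat)
    (A B : 'M[R[i]]_d) (X Y : 'M[R[i]]_(d, k)) (U : 'M[R[i]]_d) :
  herm_mx A -> herm_mx B ->
  isom_mx X -> isom_mx Y ->
  unitary_mx U -> direct_rotation X^T Y^T U ->
  let Yr := U *m X in
  submaj (svals (hadj X *m A *m X - hadj Yr *m B *m Yr))
         (vadd (svals (A - B))
               (vmul (angles X Y) (vscale (2%:R)^-1 (vadd (spr A) (spr B))))).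
Proof.
move=> hA hB iX iY uU dU Yr.
have rhsE i : ev (vadd (svals (A - B))
      (vmul (angles X Y) (vscale 2%:R^-1 (vadd (spr A) (spr B))))) i =
    ev (svals (A - B)) i +
    ev (angles X Y) i * (2^-1 * (ev (spr A) i + ev (spr B) i)).
  by rewrite ev_vadd ev_vmul ev_vscale ev_vadd.
apply: submaj_nonincr => [i|i|r]; first exact: ev_svals_nonincr.
  rewrite !rhsE lerD ?ev_svals_nonincr // ler_pM //.
  - exact: ev_angles_ge0.
  - by rewrite mulr_ge0 ?invr_ge0 // addr_ge0 ?ev_spr_ge0.
  - exact: ev_angles_nonincr.
  - by rewrite ler_wpM2l ?invr_ge0 // lerD ?ev_spr_nonincr.
rewrite [leRHS](eq_bigr (fun i : 'I_r => ev (svals (A - B)) i +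
    ev (angles X Y) i * (2^-1 * (ev (spr A) i + ev (spr B) i)))) => [|i _]; last first.
  exact: rhsE.
(* One optimal pair for the left-hand side is fixed and used in all four estimates, so that they can
   be added. *)
have [P [Q [fP fQ <-]]] := kyfan_attained r (hadj X *m A *m X - hadj Yr *m B *m Yr).
have cX := contr_isom iX.
have cYr : contr Yr := contrM (contr_isom uU) cX.
have hAX := direct_rotation_trace_le hA iX iY dU fP fQ.
have hBX := direct_rotation_trace_le hB iX iY dU fP fQ.
have hX := kyfan_compression_le A B cX fP fQ.
have hYr := kyfan_compression_le A B cYr fP fQ.
rewrite compression_trace big_split /= sum_mul_mean.
exact: mean_le hAX hBX hX hYr.
Qed.
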